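(* For integers $n\ge 0$ and $0\le k\le\binom n2$, let $w_{nk}$ denote the number of strongly connected, complete digraphs on the vertex set $\{1,\dots,n\}$ that have exactly $k$ double edges. Then: (i) for $0\le k\le\binom n2$, $w_{nk}$ is equal to the number of subsets $U\subseteq E(\mathcal D_n)$ such that $\langle U\rangle=\mathcal E_n$ and $|U|=\binom n2+k$; (ii) the number of subsets $U\subseteq E(\mathcal D_n)$ such that $\langle U\rangle=\mathcal E_n$ is equal to $\sum_{k=0}^{\binom n2}w_{nk}$. Moreover, the numbers $w_{nk}$ satisfy the recurrence $$w_{00}=1,\qquad w_{nk}=F_{nk}-\sum_{s=1}^{n-1}\binom ns\sum_{l=0}^{k}w_{sl}F_{n-s,k-l}\quad\text{for } n\ge1,$$ where $F_{nk}=\binom{\binom n2}{k}\cdot 2^{\binom n2-k}$.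
   Context: $\mathcal T_n$ is the monoid of all functions $\{1,\dots,n\}\to\{1,\dots,n\}$ under composition ($\mathcal T_0$ consists of the empty map only), and $\mathcal E_n$ is the submonoid of $\mathcal T_n$ generated by all idempotents of $\mathcal T_n$. For a subset $U$ of a monoid, $\langle U\rangle$ is the submonoid generated by $U$ (so it always contains the identity). For $n\ge2$, $\mathcal D_n=\{f\in\mathcal T_n: |\mathrm{im}(f)|=n-1\}$, and $\mathcal D_0=\mathcal D_1=\emptyset$; $E(\mathcal D_n)$ is the set of idempotents contained in $\mathcal D_n$. Explicitly $E(\mathcal D_n)=\{e_{ij}: i,j\in\{1,\dots,n\},\ i\ne j\}$, where $e_{ij}$ maps $j$ to $i$ and fixes every other point. Digraphs have no loops and, for each ordered pair $(u,v)$ of distinct vertices, at most one edge $u\to v$. A digraph on $V$ is complete if for all distinct $u,v\in V$ at least one of $u\to v$, $v\to u$ is an edge. It is strongly connected if $|V|=1$ or, for any $u,v\in V$, there is a directed path from $u$ to $v$ (the empty digraph on $0$ vertices is strongly connected). A double edge is an unordered pair $\{u,v\}$ such that both $u\to v$ and $v\to u$ are edges. Convention: $\binom ij=0$ if $j>i$; in particular $F_{nk}=0$ when $k>\binom n2$, and $w_{sl}=0$ when $l>\binom s2$. *)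

(* Defs.v *)
From HB Require Import structures.
From mathcomp Require Import all_boot all_order all_algebra.

Set Implicit Arguments.
Unset Strict Implicit.
Unset Printing Implicit Defensive.

(* An alias of {ffun 'I_n -> 'I_n}, because the latter may carry the pointwise
   product when 'I_n does; here the product is composition. *)
Definition trans (n : nat) := {ffun 'I_n -> 'I_n}.

HB.instance Definition _ n := Finite.copy (trans n) {ffun 'I_n -> 'I_n}.

Section TransMonoid.

Variable n : nat.

Definition trans_one : trans n := [ffun x => x].
Definition trans_mul (f g : trans n) : trans n := [ffun x => f (g x)].

Lemma trans_mulA : associative trans_mul.
Proof. by move=> f g h; apply/ffunP => x; rewrite !ffunE. Qed.

Lemma trans_mul1f : left_id trans_one trans_mul.
Proof. by move=> f; apply/ffunP => x; rewrite !ffunE. Qed.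

Lemma trans_mulf1 : right_id trans_one trans_mul.
Proof. by move=> f; apply/ffunP => x; rewrite !ffunE. Qed.

HB.instance Definition _ :=
  isMonoid.Build (trans n) trans_mulA trans_mul1f trans_mulf1.

Definition submonoid (S : {set trans n}) : bool :=
  (1%g \in S) && [forall f in S, forall g in S, (f * g)%g \in S].

Definition generated (U : {set trans n}) : {set trans n} :=
  \bigcap_(S : {set trans n} | submonoid S && (U \subset S)) S.

Definition idempotent_trans (f : trans n) : bool := (f * f)%g == f.

Definition idem_generated : {set trans n} :=
  generated [set f | idempotent_trans f].

(* The guard 1 < n only matters for n = 0, where n.-1 = 0 and the empty map
   would otherwise qualify. *)
Definition defect1 : {set trans n} :=
  [set f : trans n | (1 < n) && (#|[set f x | x : 'I_n]| == n.-1)].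

Definition idem_defect1 : {set trans n} :=
  [set f in defect1 | idempotent_trans f].

End TransMonoid.

(* A digraph on 'I_n is given by its edge set: (u, v) \in E means u -> v. *)
Section Digraph.

Variables (n : nat) (E : {set 'I_n * 'I_n}).

Definition loopless : bool := [forall u, (u, u) \notin E].

Definition complete : bool :=
  [forall u, forall v, (u != v) ==> ((u, v) \in E) || ((v, u) \in E)].

Definition strongly_connected : bool :=
  [forall u, forall v, connect (fun x y => (x, y) \in E) u v].

Definition double_edges : {set {set 'I_n}} :=
  [set [set e.1; e.2] | e in E & (e.2, e.1) \in E].

End Digraph.

Definition w (n k : nat) : nat :=
  #|[set E : {set 'I_n * 'I_n} |
      [&& loopless E, complete E, strongly_connected E
        & #|double_edges E| == k]]|.

Definition F (n k : nat) : nat := 'C('C(n, 2), k) * 2 ^ ('C(n, 2) - k).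

Definition generating_sets (n : nat) : {set {set trans n}} :=
  [set U : {set trans n} |
    (U \subset idem_defect1 n) && (generated U == idem_generated n)].

(* Main.v *)
(* Write move u v for the idempotent sending u to v, and identify a set U of
   defect one idempotents with the digraph whose edges u -> v are the moves in
   U.  A product of moves sends every point along a path of the digraph, and
   the first factor of a product equal to move u v must already identify u
   and v; so a generating set gives a strongly connected, complete digraph.
   Conversely, going around a directed triangle with one vacated point reverses
   each of its edges; hence, in a complete digraph, the relation "move u v is
   generated" is transitive, and strong connectedness makes it full.

   For the recurrence, a nonempty complete digraph has exactly one strongly
   connected set S of vertices that no edge enters: it is an arbitrary strongly
   connected complete digraph on S and an arbitrary complete digraph on the
   complement, all edges between the two being single and leaving S.  A complete
   digraph has binomial(n, 2) + (number of double edges) edges, which makes the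
   number of double edges additive in this decomposition. *)
Require Import Defs.
From mathcomp Require Import all_boot all_order all_algebra.
From mathcomp Require Import zify.

Set Implicit Arguments.
Unset Strict Implicit.
Unset Printing Implicit Defensive.

(** * Generating sets of defect one idempotents *)

Definition move n (u v : 'I_n) : trans n := [ffun x => if x == u then v else x].

Definition edge n (E : {set 'I_n * 'I_n}) : rel 'I_n := fun x y => (x, y) \in E.

Lemma moveE n (u v x : 'I_n) : move u v x = if x == u then v else x.
Proof. by rewrite ffunE. Qed.

Lemma mul_transE n (f g : trans n) x : (f * g)%g x = f (g x).
Proof. by rewrite ffunE. Qed.

Lemma one_transE n x : (1%g : trans n) x = x.
Proof. by rewrite ffunE. Qed.

Lemma submonoidP n (S : {set trans n}) :
  reflect (1%g \in S /\ {in S &, forall f g, (f * g)%g \in S}) (submonoid S).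
Proof.
apply: (iffP andP) => [[S1 /forall_inP SM]|[S1 SM]]; split=> //.
  by move=> f g Sf Sg; apply: (forall_inP (SM f Sf)).
by apply/forall_inP => f Sf; apply/forall_inP => g Sg; apply: SM.
Qed.

Lemma submonoid_generated n (U : {set trans n}) : submonoid (generated U).
Proof.
apply/submonoidP; split=> [|f g /bigcapP Uf /bigcapP Ug].
  by apply/bigcapP => S /andP[/submonoidP[]].
apply/bigcapP => S SU; have /andP[/submonoidP[_ SM] _] := SU.
by apply: SM; [apply: Uf | apply: Ug].
Qed.

Lemma mul_generated n (U : {set trans n}) :
  {in generated U &, forall f g, (f * g)%g \in generated U}.
Proof. by have /submonoidP[] := submonoid_generated U. Qed.

Lemma one_generated n (U : {set trans n}) : 1%g \in generated U.
Proof. by have /submonoidP[] := submonoid_generated U. Qed.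

Lemma sub_generated n (U : {set trans n}) : U \subset generated U.
Proof. by apply/bigcapsP => S /andP[]. Qed.

Lemma generated_min n (U S : {set trans n}) :
  submonoid S -> U \subset S -> generated U \subset S.
Proof. by move=> mS US; apply: bigcap_inf; rewrite mS. Qed.

Lemma move_idempotent n (u v : 'I_n) : idempotent_trans (move u v).
Proof.
apply/eqP/ffunP => x; rewrite mul_transE !moveE.
by case: (eqVneq x u) => [_|/negPf->] //; case: eqP.
Qed.

Lemma move_inj n (u v u' v' : 'I_n) :
  u != v -> u' != v' -> move u v = move u' v' -> (u, v) = (u', v').
Proof.
move=> uv uv' eq_m; have := congr1 (fun f : trans n => f u) eq_m.
rewrite !moveE eqxx; case: (eqVneq u u') => [-> -> //|_ vu].
by rewrite vu eqxx in uv.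
Qed.

(** An idempotent fixes every point of its image. At defect one the image omits a single point [u],
    so [u] is the only point that moves. *)
Lemma idem_defect1P n (f : trans n) :
  reflect (exists u v, u != v /\ f = move u v) (f \in idem_defect1 n).
Proof.
apply: (iffP idP) => [|[u [v [uv ->]]]].
  rewrite !inE => /andP[/andP[n1 /eqP imf] /eqP idf].
  have ffE x : f (f x) = f x by rewrite -[in RHS]idf mul_transE.
  have /eqP/cards1P[u defu]: #|~: [set f x | x : 'I_n]| = 1.
    by rewrite cardsCs setCK imf card_ord -subn1 subKn // ltnW.
  have fix_ne x : x != u -> f x = x.
    move=> xu; have: x \notin ~: [set f x | x : 'I_n] by rewrite defu inE.
    by rewrite inE negbK => /imsetP[y _ ->].
  exists u, (f u); split.
    have: u \in ~: [set f x | x : 'I_n] by rewrite defu inE.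
    by apply: contraTneq => ->; rewrite inE negbK imset_f.
  by apply/ffunP => x; rewrite moveE; case: eqVneq => [->|/fix_ne].
rewrite !inE move_idempotent andbT; apply/andP; split.
  by rewrite -[n]card_ord; apply/card_gt1P; exists u, v.
have ->: [set move u v x | x : 'I_n] = ~: [set u].
  apply/setP => y; rewrite !inE; apply/imsetP/idP => [[x _ ->]|yu].
    by rewrite moveE; case: (eqVneq x u) => // _; rewrite eq_sym.
  by exists y => //; rewrite moveE (negPf yu).
by rewrite cardsCs setCK cards1 card_ord subn1.
Qed.

(* Moving the non-fixed points one at a time writes an idempotent as a product
   of defect one idempotents. *)
Lemma idempotent_generated n (f : trans n) :
  idempotent_trans f -> f \in generated (idem_defect1 n).
Proof.
have [m] := ubnP #|[set x | f x != x]|.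
elim: m f => // m IHm f /ltnSE le_m /eqP idf.
have ffE x : f (f x) = f x by rewrite -[in RHS]idf mul_transE.
case: (set_0Vmem [set x | f x != x]) => [f1|[u]].
  have ->: f = 1%g.
    apply/ffunP => x; rewrite one_transE; apply/eqP/negPn/negP => fx.
    by have := in_set0 x; rewrite -f1 inE fx.
  exact: one_generated.
(* [g] agrees with [f] except that it also fixes [u], so it moves fewer points. Since [u] is outside
   the image of [f], [g] is still idempotent. *)
rewrite inE => fu; pose g : trans n := [ffun x => if x == u then u else f x].
have f_ne x : f x != u by apply: contra fu => /eqP <-; rewrite ffE.
have ->: f = (g * move u (f u))%g.
  apply/ffunP => x; rewrite mul_transE moveE ffunE.
  by case: (eqVneq x u) => [->|xu]; rewrite ?(negPf fu) ?(negPf xu) ?ffE.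
apply: mul_generated; last first.
  apply: (subsetP (sub_generated _)); apply/idem_defect1P.
  by exists u, (f u); rewrite eq_sym.
apply: IHm.
  apply: leq_trans le_m; apply: proper_card; apply/properP; split.
    by apply/subsetP => x; rewrite !inE ffunE; case: (eqVneq x u) => [->|].
  by exists u; rewrite !inE ?fu // ffunE eqxx eqxx.
apply/eqP/ffunP => x; rewrite mul_transE !ffunE.
by case: (eqVneq x u) => [|_]; rewrite ?eqxx // (negPf (f_ne x)) ffE.
Qed.

(** By [idempotent_generated], the moves already generate the whole of [idem_generated n], so only
    they have to be found in [generated U]. *)
Lemma generated_eqP n (U : {set trans n}) : U \subset idem_defect1 n ->
  reflect (forall u v, u != v -> move u v \in generated U)
          (generated U == idem_generated n).
Proof.
move=> Ud; apply: (iffP eqP) => [-> u v _|allU].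
  by apply: (subsetP (sub_generated _)); rewrite inE move_idempotent.
apply/eqP; rewrite eqEsubset; apply/andP; split; apply: generated_min;
  rewrite ?submonoid_generated //.
  apply: subset_trans (sub_generated _); apply/subsetP => f /(subsetP Ud).
  by rewrite !inE => /andP[].
apply/subsetP => f; rewrite inE => /idempotent_generated; apply/subsetP.
apply: generated_min; rewrite ?submonoid_generated //.
by apply/subsetP => g /idem_defect1P[u [v [uv ->]]]; apply: allU.
Qed.

(* Collapse c onto a, then push the three positions around the cycle through
   the vacated point until a and c both sit on c and b is back in place. *)
Lemma move_triangle n (a b c : 'I_n) : a != b -> b != c -> c != a ->
  move a c = (move a b * move b c * move c a * move a b * move b c
              * move c a)%g.
Proof.
move=> ab bc ca; apply/ffunP => x; rewrite !mul_transE !moveE.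
have [ba cb ac] : [/\ b != a, c != b & a != c] by rewrite eq_sym ab eq_sym bc eq_sym.
have E := (negPf ab, negPf bc, negPf ca, negPf ba, negPf cb, negPf ac, eqxx).
case: (eqVneq x a) => [->|/negPf xa]; first by do ?rewrite E /=.
case: (eqVneq x c) => [->|/negPf xc]; first by do ?rewrite E /=.
case: (eqVneq x b) => [->|/negPf xb]; first by do ?rewrite E /=.
by do ?rewrite (xa, xb, xc) /=.
Qed.

Definition moves n (E : {set 'I_n * 'I_n}) : {set trans n} :=
  [set move e.1 e.2 | e in E].

Lemma loopless_neq n (E : {set 'I_n * 'I_n}) u v :
  loopless E -> (u, v) \in E -> u != v.
Proof. by move=> /forallP/(_ u) lE; apply: contraTneq => <-. Qed.

Lemma moves_sub n (E : {set 'I_n * 'I_n}) :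
  loopless E -> moves E \subset idem_defect1 n.
Proof.
move=> lE; apply/subsetP => _ /imsetP[[u v] Euv ->].
by apply/idem_defect1P; exists u, v; split=> //; apply: loopless_neq Euv.
Qed.

Lemma generating_connected n (E : {set 'I_n * 'I_n}) f x :
  f \in generated (moves E) -> connect (edge E) x (f x).
Proof.
pose S := [set f : trans n | [forall x, connect (edge E) x (f x)]].
suff /subsetP sS : generated (moves E) \subset S.
  by move/sS; rewrite inE => /forallP.
apply: generated_min.
  apply/submonoidP; split; first by rewrite inE; apply/forallP => y; rewrite one_transE.
  move=> g h; rewrite !inE => /forallP cg /forallP ch; apply/forallP => y.
  by rewrite mul_transE; apply: connect_trans (cg _).
apply/subsetP => _ /imsetP[[u v] Euv ->]; rewrite inE; apply/forallP => y.
by rewrite moveE /=; case: eqP => // ->; apply: connect1.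
Qed.

(** The disjunction is stable under products because the right factor acts first: if it merges the
    ends of an edge, so does the product; if it is the identity, the product is the left factor. *)
Lemma generating_collapse n (E : {set 'I_n * 'I_n}) f :
  f \in generated (moves E) ->
  f = 1%g \/ exists u v, (u, v) \in E /\ f u = f v.
Proof.
pose S := [set f : trans n | (f == 1%g) || [exists e in E, f e.1 == f e.2]].
suff /subsetP sS : generated (moves E) \subset S.
  move/sS; rewrite inE => /orP[/eqP->|/exists_inP[[u v] Euv /eqP fuv]].
    by left.
  by right; exists u, v.
apply: generated_min.
  apply/submonoidP; split; first by rewrite inE eqxx.
  move=> g h; rewrite !inE => Sg /orP[/eqP->|/exists_inP[e Ee /eqP he]].
    by rewrite mulg1.
  by apply/orP; right; apply/exists_inP; exists e; rewrite // !mul_transE he.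
apply/subsetP => _ /imsetP[[u v] Euv ->]; rewrite inE; apply/orP; right.
apply/exists_inP; exists (u, v) => //=.
by rewrite !moveE eqxx; case: (v == u).
Qed.

Lemma move_collapse n (u v a b : 'I_n) : a != b -> move u v a = move u v b ->
  (a, b) = (u, v) \/ (a, b) = (v, u).
Proof.
rewrite !moveE; case: (eqVneq a u) => [->|_]; case: (eqVneq b u) => [->|_].
- by [].
- by move=> _ ->; left.
- by move=> _ ->; right.
- by move=> + eq_ab; rewrite eq_ab eqxx.
Qed.

Lemma generated_trans n (E : {set 'I_n * 'I_n}) (a b c : 'I_n) :
  complete E -> a != b -> b != c -> a != c ->
  move a b \in generated (moves E) -> move b c \in generated (moves E) ->
  move a c \in generated (moves E).
Proof.
move=> /forallP/(_ a)/forallP/(_ c)/implyP cE ab bc ac Mab Mbc.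
have inM u v : (u, v) \in E -> move u v \in generated (moves E).
  by move=> Euv; apply: (subsetP (sub_generated _)); apply/imsetP; exists (u, v).
(* Either [a] has an edge to [c] and nothing is left to do, or the edge from [c] to [a] closes the
   triangle of [move_triangle]. *)
have /orP[/inM //|/inM Mca] := cE ac.
by rewrite (move_triangle ab bc) 1?eq_sym //; do !apply: mul_generated.
Qed.

Lemma generatingE n (E : {set 'I_n * 'I_n}) : loopless E ->
  (generated (moves E) == idem_generated n)
    = complete E && strongly_connected E.
Proof.
move=> lE; apply/(generated_eqP (moves_sub lE))/andP => [gE|[cE scE] u v].
  split; apply/forallP => u; apply/forallP => v.
    apply/implyP => uv.
    (* [move u v] merges no pair but [u] and [v], so the edge that it collapses joins these two. *)
    have [m1|[a [b [Eab]]]] := generating_collapse (gE u v uv).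
      have := congr1 (fun f : trans n => f u) m1.
      by rewrite moveE eqxx one_transE => vu; rewrite vu eqxx in uv.
    move/(move_collapse (loopless_neq lE Eab)) => [|] [<- <-]; rewrite Eab ?orbT //.
  case: (eqVneq u v) => [->|uv]; first exact: connect0.
  by have := generating_connected u (gE u v uv); rewrite moveE eqxx.
(* Induction along a path from [u] to [v]: the moves along its edges are composed by
   [generated_trans]. *)
have /connectP[p] := forallP (forallP scE u) v.
elim: p u => [|w p IHp] u /=; first by move=> _ ->; rewrite eqxx.
case/andP=> Euw pw defv uv; have uw := loopless_neq lE Euw.
have Muw : move u w \in generated (moves E).
  by apply: (subsetP (sub_generated _)); apply/imsetP; exists (u, w).
case: (eqVneq w v) => [<- //|wv].
exact: generated_trans (IHp w pw defv wv).
Qed.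

Lemma moves_inj n :
  {in [pred E : {set 'I_n * 'I_n} | loopless E] &, injective (@moves n)}.
Proof.
move=> E E'; rewrite !inE.
wlog suff sub: E E' / loopless E -> loopless E' -> moves E = moves E' -> E \subset E'.
  move=> lE lE' eqM; apply/eqP; rewrite eqEsubset.
  by rewrite (sub _ _ lE lE' eqM) (sub _ _ lE' lE (esym eqM)).
move=> lE lE' eqM; apply/subsetP => -[u v] Euv.
have: move u v \in moves E by apply/imsetP; exists (u, v).
rewrite eqM => /imsetP[[u' v'] Euv'] /move_inj ->//.
  exact: loopless_neq Euv.
exact: loopless_neq Euv'.
Qed.

Lemma card_moves n (E : {set 'I_n * 'I_n}) : loopless E -> #|moves E| = #|E|.
Proof.
move=> lE; apply: card_in_imset => -[u v] [u' v'] Euv Euv' /move_inj; apply.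
  exact: loopless_neq Euv.
exact: loopless_neq Euv'.
Qed.

Lemma generating_setsE n :
  generating_sets n =
    [set moves E | E in [set E | [&& loopless E, complete E & strongly_connected E]]].
Proof.
apply/setP => U; rewrite inE; apply/andP/imsetP => [[Ud gU]|[E]]; last first.
  rewrite inE => /and3P[lE cE sE] ->.
  by rewrite moves_sub // generatingE // cE sE.
pose E := [set e : 'I_n * 'I_n | (e.1 != e.2) && (move e.1 e.2 \in U)].
have lE : loopless E by apply/forallP => u; rewrite inE eqxx.
have defU : U = moves E.
  apply/setP => f; apply/idP/imsetP => [Uf|[e]]; last by rewrite inE => /andP[_ ? ->].
  have /idem_defect1P[u [v [uv deff]]] := subsetP Ud f Uf.
  by exists (u, v); rewrite // inE /= uv -deff.
by exists E; rewrite // inE lE -generatingE // -defU.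
Qed.

(** * Counting complete digraphs *)

Lemma completeP n (E : {set 'I_n * 'I_n}) :
  reflect (forall u v, u != v -> ((u, v) \in E) || ((v, u) \in E)) (complete E).
Proof.
apply: (iffP forallP) => cE u; first by move=> v; have /forallP/(_ v)/implyP := cE u.
by apply/forallP => v; apply/implyP; apply: cE.
Qed.

Lemma loopless_irr n (E : {set 'I_n * 'I_n}) u : loopless E -> (u, u) \in E = false.
Proof. by move=> /forallP/(_ u)/negPf. Qed.

Definition converse n (E : {set 'I_n * 'I_n}) : {set 'I_n * 'I_n} :=
  [set e | (e.2, e.1) \in E].

Lemma card_converse n (E : {set 'I_n * 'I_n}) : #|converse E| = #|E|.
Proof.
have swapK : involutive (fun e : 'I_n * 'I_n => (e.2, e.1)) by case.
rewrite -(card_imset (mem E) (inv_inj swapK)); apply: eq_card => e.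
by rewrite inE -[in RHS](swapK e) mem_imset //; apply: inv_inj.
Qed.

(** Increasing pairs stand for the unordered pairs of distinct vertices, so that double edges and
    choices of orientation become subsets of one set. *)
Definition upper n : {set 'I_n * 'I_n} :=
  [set e : 'I_n * 'I_n | e.1 < e.2].

Lemma upper_pair_inj n :
  {in upper n &, injective (fun e : 'I_n * 'I_n => [set e.1; e.2])}.
Proof.
move=> [a b] [c d]; rewrite !inE /= => ab cd eqS.
have /set2P Ha : a \in [set c; d] by rewrite -eqS set21.
have /set2P Hb : b \in [set c; d] by rewrite -eqS set22.
by case: Ha Hb ab cd => -> [] -> //; rewrite ?ltnn // => /ltnW; rewrite leqNgt => /negPf->.
Qed.

Lemma card_upper n : #|upper n| = 'C(n, 2).
Proof.
rewrite -(card_in_imset (@upper_pair_inj n)) -[in RHS](card_ord n) -card_draws.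
apply: eq_card => A; rewrite inE; apply/imsetP/cards2P => [[[a b]]|[a [b [ab ->]]]].
  by rewrite inE /= => ab ->; exists a, b; split=> //; apply: contraTneq ab => ->; rewrite ltnn.
case: (ltngtP a b) => [lt_ab|lt_ba|/val_inj eq_ab].
- by exists (a, b); rewrite ?inE.
- by exists (b, a); rewrite ?inE //= setUC.
- by rewrite eq_ab eqxx in ab.
Qed.

Definition upper_double n (E : {set 'I_n * 'I_n}) : {set 'I_n * 'I_n} :=
  E :&: converse E :&: upper n.

Lemma card_upper_double n (E : {set 'I_n * 'I_n}) : loopless E ->
  #|double_edges E| = #|upper_double E|.
Proof.
move=> lE; rewrite -(card_in_imset (f := fun e : 'I_n * 'I_n => [set e.1; e.2]) (D := upper_double E)); last first.
  by move=> e e' /setIP[_ Le] /setIP[_ Le']; apply: upper_pair_inj.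
congr #|pred_of_set _|; apply/setP => A; apply/imsetP/imsetP => -[[a b]]; rewrite !inE /=.
  case/andP=> Eab Eba ->; case: (ltngtP a b) => [lt_ab|lt_ba|/val_inj eq_ab].
  - by exists (a, b); rewrite ?inE /= ?Eab ?Eba.
  - by exists (b, a); rewrite ?inE /= ?Eab ?Eba // setUC.
  - by rewrite eq_ab loopless_irr in Eab.
by case/andP=> /andP[Eab Eba] _ ->; exists (a, b); rewrite ?inE /= ?Eab.
Qed.

(** Reverse the decreasing edges. Together with the increasing ones they cover [upper n] by
    completeness, and the overlap consists of the double edges. *)
Lemma card_complete_digraph n (E : {set 'I_n * 'I_n}) : loopless E -> complete E ->
  #|E| = 'C(n, 2) + #|double_edges E|.
Proof.
move=> lE /completeP cE; rewrite card_upper_double // -card_upper.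
rewrite -(cardsID (upper n) E).
have ->: #|E :\: upper n| = #|converse E :&: upper n|.
  rewrite -(card_converse (_ :&: _)); apply: eq_card => -[u v]; rewrite !inE /= -leqNgt andbC.
  by case: (ltngtP v u) => [||/val_inj->]; rewrite ?andbF ?andbT // loopless_irr.
rewrite -cardsUI; congr addn; apply: eq_card => -[u v]; rewrite !inE /=.
  rewrite -andb_orl; case: ltnP => [lt_uv|_]; rewrite ?andbF // cE //.
  by apply: contraTneq lt_uv => ->; rewrite ltnn.
by case: ((u, v) \in E); rewrite ?andbF //=; case: ((v, u) \in E); rewrite ?andbF ?andbb.
Qed.

(* The complete digraph on 'I_n whose double edges are K and whose other
   increasing edges are A. *)
Definition orient n (K A : {set 'I_n * 'I_n}) : {set 'I_n * 'I_n} :=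
  A :|: K :|: converse (upper n :\: A).

Lemma orientE n (K A : {set 'I_n * 'I_n}) u v :
  K \subset upper n -> A \subset upper n :\: K ->
  ((u, v) \in orient K A) =
    if u < v then ((u, v) \in A) || ((u, v) \in K)
    else (v < u) && ((v, u) \notin A).
Proof.
move=> /subsetP KL /subsetP AL; rewrite !inE /=.
case: (boolP (u < v)) => [uv|/negPf nuv].
  by rewrite [v < u]ltnNge (ltnW uv) andbF orbF.
have AF : ((u, v) \in A) = false by apply/negP => /AL; rewrite !inE /= nuv andbF.
have KF : ((u, v) \in K) = false by apply/negP => /KL; rewrite inE /= nuv.
by rewrite AF KF andbC.
Qed.

(** Each pair outside [K] carries one edge, whose direction is free: [orient K] is a bijection from
    the subsets of [upper n :\: K]. *)
Lemma card_digraphs_upper_double n (K : {set 'I_n * 'I_n}) : K \subset upper n ->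
  #|[set E : {set 'I_n * 'I_n} | [&& loopless E, complete E & upper_double E == K]]|
    = 2 ^ ('C(n, 2) - #|K|).
Proof.
move=> KL; have sL := subsetP KL.
rewrite -card_upper -cardsDS // -card_powerset.
rewrite -(card_in_imset (f := orient K) (D := powerset (upper n :\: K))); last first.
  move=> A A'; rewrite !inE => AL AL' eqO; apply/setP => -[u v].
  have /subsetP/(_ (u, v)) := AL; have /subsetP/(_ (u, v)) := AL'.
  rewrite !inE /=; move/setP/(_ (u, v)): eqO; rewrite !orientE //.
  have absurd (a a' : bool) : (a' -> false) -> (a -> false) -> a = a'.
    by case: a => [_ /(_ isT)//|]; case: a' => // /(_ isT).
  case: (ltnP u v) => _; last by rewrite andbF => _; apply: absurd.
  by rewrite andbT; case: ((u, v) \in K); rewrite ?orbF ?orbT //= => _; apply: absurd.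
apply: eq_card => E; rewrite inE; apply/and3P/imsetP => [[lE /completeP cE /eqP dE]|[A]].
  exists ((E :&: upper n) :\: K).
    by rewrite inE setSD // subsetIr.
  apply/setP => -[u v]; rewrite orientE ?setSD ?subsetIr // -dE !inE /=.
  case: (ltngtP u v) => [uv|vu|/val_inj->].
  - by case: ((u, v) \in E); case: ((v, u) \in E).
  - have := cE u v; case: (eqVneq u v) => [eq_uv|_]; first by rewrite eq_uv ltnn in vu.
    by move/(_ isT); case: ((u, v) \in E); case: ((v, u) \in E).
  - by rewrite loopless_irr.
rewrite inE => AL ->; have sA := subsetP AL; split.
- by apply/forallP => u; rewrite orientE // ltnn.
- apply/completeP => u v uv; rewrite !orientE //.
  case: (ltngtP u v) => [_|_|/val_inj eq_uv] /=.
  + by rewrite orbAC orbN.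
  + by rewrite orbA orNb.
  + by rewrite eq_uv eqxx in uv.
apply/eqP/setP => -[u v]; rewrite /upper_double 2!inE [in X in _ && X]inE /=.
rewrite [_ \in converse _]inE /= !orientE //.
have := sL (u, v); have := sA (u, v); rewrite !inE /=.
case: (ltngtP u v) => _ /=; rewrite ?andbF ?andbT.
- by case: (_ \in A); case: (_ \in K) => //=; move/(_ isT).
- by case: (_ \in K) => // _ /(_ isT).
- by case: (_ \in K) => // _ /(_ isT).
Qed.

Lemma card_digraphs n k :
  #|[set E : {set 'I_n * 'I_n} | [&& loopless E, complete E & #|double_edges E| == k]]|
    = F n k.
Proof.
pose Q (K : {set 'I_n * 'I_n}) := (K \subset upper n) && (#|K| == k).
rewrite -sum1_card (partition_big (@upper_double n) Q) => [|E]; last first.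
  by rewrite inE /Q => /and3P[lE _ /eqP<-]; rewrite subsetIr card_upper_double /=.
rewrite (eq_bigr (fun=> 2 ^ ('C(n, 2) - k))) => [|K /andP[KL /eqP cK]]; last first.
  have := card_digraphs_upper_double KL; rewrite cK -sum1_card => <-; apply: eq_bigl => E.
  rewrite !inE; case lE: (loopless E) => //=; rewrite card_upper_double //.
  by case: complete => //=; case: (upper_double E =P K) => [->|_]; rewrite ?cK ?eqxx ?andbF.
rewrite sum_nat_const /F; congr (_ * _); rewrite -card_upper -cards_draws.
by apply: eq_card => K; rewrite !inE.
Qed.

(** * Digraphs supported on a subset of vertices *)

Definition complete_on n (D : {set 'I_n}) (E : {set 'I_n * 'I_n}) : bool :=
  [forall u in D, forall v in D, (u != v) ==> ((u, v) \in E) || ((v, u) \in E)].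

Definition strong_on n (D : {set 'I_n}) (E : {set 'I_n * 'I_n}) : bool :=
  [forall u in D, forall v in D, connect (edge E) u v].

(** The edges remain pairs over ['I_n], so that digraphs on disjoint vertex sets can be united
    without relabelling. *)
Definition digraphs n (D : {set 'I_n}) : {set {set 'I_n * 'I_n}} :=
  [set E : {set 'I_n * 'I_n} | E \subset setX D D & loopless E && complete_on D E].

Definition strong_digraphs n (D : {set 'I_n}) : {set {set 'I_n * 'I_n}} :=
  [set E in digraphs D | strong_on D E].

(* The number of double edges of a complete digraph on D. *)
Definition excess n (D : {set 'I_n}) (E : {set 'I_n * 'I_n}) : nat :=
  #|E| - 'C(#|D|, 2).

Lemma complete_onP n (D : {set 'I_n}) (E : {set 'I_n * 'I_n}) :
  reflect {in D &, forall u v, u != v -> ((u, v) \in E) || ((v, u) \in E)}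
          (complete_on D E).
Proof.
apply: (iffP forall_inP) => [cE u v Du Dv|cE u Du].
  by have /forall_inP/(_ v Dv)/implyP := cE u Du.
by apply/forall_inP => v Dv; apply/implyP; apply: cE.
Qed.

Lemma strong_onP n (D : {set 'I_n}) (E : {set 'I_n * 'I_n}) :
  reflect {in D &, forall u v, connect (edge E) u v} (strong_on D E).
Proof.
apply: (iffP forall_inP) => [cE u v Du Dv|cE u Du].
  by have /forall_inP/(_ v Dv) := cE u Du.
by apply/forall_inP => v Dv; apply: cE.
Qed.

Lemma homo_connect (T T' : finType) (e : rel T) (e' : rel T') (h : T -> T') :
  {homo h : x y / e x y >-> e' x y} -> {homo h : x y / connect e x y >-> connect e' x y}.
Proof.
move=> eh x y /connectP[p pe ->]; rewrite -last_map.
by apply/connectP; exists (map h p) => //; apply: homo_path pe.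
Qed.

(** Relabels the standard vertex set of size [#|D|] as [D], which carries the counts [F] and [w]
    over to subsets. *)
Definition embed n (D : {set 'I_n}) (e : 'I_#|D| * 'I_#|D|) : 'I_n * 'I_n :=
  (enum_val e.1, enum_val e.2).

Lemma embed_inj n (D : {set 'I_n}) : injective (@embed n D).
Proof. by move=> [a b] [c d] [/enum_val_inj -> /enum_val_inj ->]. Qed.

Lemma mem_embed n (D : {set 'I_n}) (E : {set 'I_#|D| * 'I_#|D|}) u v :
  ((enum_val u, enum_val v) \in @embed n D @: E) = ((u, v) \in E).
Proof. by rewrite -(mem_imset _ _ (@embed_inj n D)). Qed.

Lemma loopless_embed n (D : {set 'I_n}) (E : {set 'I_#|D| * 'I_#|D|}) :
  loopless (@embed n D @: E) = loopless E.
Proof.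
apply/forallP/forallP => lE u; first by rewrite -mem_embed.
by apply/negP => /imsetP[[a b] Eab [-> /enum_val_inj eq_ab]]; have := lE a; rewrite {2}eq_ab Eab.
Qed.

Lemma complete_on_embed n (D : {set 'I_n}) (E : {set 'I_#|D| * 'I_#|D|}) :
  complete_on D (@embed n D @: E) = complete E.
Proof.
apply/complete_onP/completeP => cE u v.
  move=> uv; rewrite -!mem_embed; apply: cE; rewrite ?enum_valP //.
  by rewrite (inj_eq enum_val_inj).
move=> Du Dv; rewrite -(enum_rankK_in Du Du) -(enum_rankK_in Du Dv) !mem_embed.
by rewrite (inj_eq enum_val_inj); apply: cE.
Qed.

Lemma strong_on_embed n (D : {set 'I_n}) (E : {set 'I_#|D| * 'I_#|D|}) :
  strong_on D (@embed n D @: E) = strongly_connected E.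
Proof.
apply/strong_onP/forallP => cE u; last first.
  move=> v Du Dv; rewrite -(enum_rankK_in Du Du) -(enum_rankK_in Du Dv).
  have /forallP/(_ (enum_rank_in Du v)) := cE (enum_rank_in Du u).
  by apply: homo_connect => x y; rewrite /edge mem_embed.
apply/forallP => v; have Du := enum_valP u.
rewrite -(enum_valK_in Du u) -(enum_valK_in Du v).
apply: homo_connect (cE _ _ Du (enum_valP v)) => x y /imsetP[[a b] Eab [-> ->]].
by rewrite !enum_valK_in.
Qed.

Lemma card_embed n (D : {set 'I_n}) (Q : pred {set 'I_n * 'I_n}) :
  #|[set E : {set 'I_n * 'I_n} | (E \subset setX D D) && Q E]|
    = #|[set E : {set 'I_#|D| * 'I_#|D|} | Q (@embed n D @: E)]|.
Proof.
rewrite -[RHS](card_imset _ (imset_inj (@embed_inj n D))); apply: eq_card => E.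
rewrite inE; apply/andP/imsetP => [[ED QE]|[E']].
  have defE : E = @embed n D @: (@embed n D @^-1: E).
    apply/setP => -[u v]; apply/idP/imsetP => [Euv|[e]]; last by rewrite inE => ? ->.
    have /setXP[/= Du Dv] := subsetP ED _ Euv.
    exists (enum_rank_in Du u, enum_rank_in Du v); rewrite ?inE /embed /= !enum_rankK_in //.
  by exists (@embed n D @^-1: E) => //; rewrite inE -defE.
rewrite inE => QE ->; split=> //; apply/subsetP => _ /imsetP[e _ ->].
by rewrite inE !enum_valP.
Qed.

Lemma excess_embed n (D : {set 'I_n}) (E : {set 'I_#|D| * 'I_#|D|}) :
  loopless E -> complete E -> excess D (@embed n D @: E) = #|double_edges E|.
Proof.
move=> lE cE; rewrite /excess card_imset; last exact: embed_inj.
by rewrite card_complete_digraph // addKn.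
Qed.

Lemma card_digraphs_on n (D : {set 'I_n}) k :
  #|[set E in digraphs D | excess D E == k]| = F #|D| k.
Proof.
pose Q E := [&& loopless E, complete_on D E & excess D E == k].
rewrite -card_digraphs -(eq_card (A := [set E : {set 'I_n * 'I_n} | (E \subset setX D D) && Q E])).
  rewrite card_embed; apply: eq_card => E; rewrite !inE /Q loopless_embed complete_on_embed.
  by case lE: loopless => //; case cE: complete => //; rewrite excess_embed.
by move=> E; rewrite !inE -!andbA.
Qed.

Lemma card_strong_digraphs_on n (D : {set 'I_n}) k :
  #|[set E in strong_digraphs D | excess D E == k]| = w #|D| k.
Proof.
pose Q E := [&& loopless E, complete_on D E, strong_on D E & excess D E == k].
rewrite -(eq_card (A := [set E : {set 'I_n * 'I_n} | (E \subset setX D D) && Q E])).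
  rewrite card_embed; apply: eq_card => E.
  rewrite !inE /Q loopless_embed complete_on_embed strong_on_embed.
  by case lE: loopless => //; case cE: complete => //; rewrite excess_embed.
by move=> E; rewrite !inE -!andbA.
Qed.

(** Ensures that the truncated subtraction in [excess] is exact. The set of counterexamples is
    transported by [card_embed] to the standard vertex set, where [card_complete_digraph] shows it
    empty. *)
Lemma digraphs_lower_bound n (D : {set 'I_n}) E : E \in digraphs D -> 'C(#|D|, 2) <= #|E|.
Proof.
pose Q E := [&& loopless E, complete_on D E & #|E| < 'C(#|D|, 2)].
have: #|[set E : {set 'I_n * 'I_n} | (E \subset setX D D) && Q E]| = 0.
  rewrite card_embed; apply: eq_card0 => E'; rewrite !inE /Q loopless_embed complete_on_embed.
  rewrite card_imset; last exact: embed_inj.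
  by apply/and3P => -[lE cE]; rewrite card_complete_digraph // ltnNge leq_addr.
move/eqP; rewrite cards_eq0 => /eqP Q0; rewrite inE => /and3P[ED lE cE].
by have := in_set0 E; rewrite -Q0 inE ED /Q lE cE /= ltnNge => /negbFE.
Qed.

(** * The source component *)

Definition glue n (S : {set 'I_n}) (p : {set 'I_n * 'I_n} * {set 'I_n * 'I_n}) :
  {set 'I_n * 'I_n} := p.1 :|: p.2 :|: setX S (~: S).

(** Strong connectedness is asked of the digraph induced on [S], which is the piece that [glue]
    takes from [strong_digraphs S]. *)
Definition is_source n (S : {set 'I_n}) (E : {set 'I_n * 'I_n}) : bool :=
  [&& S != set0, [forall u, forall v in S, ((u, v) \in E) ==> (u \in S)]
    & strong_on S (E :&: setX S S)].

Lemma is_sourceP n (S : {set 'I_n}) (E : {set 'I_n * 'I_n}) :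
  reflect [/\ S != set0, forall u v, (u, v) \in E -> v \in S -> u \in S
            & strong_on S (E :&: setX S S)] (is_source S E).
Proof.
apply: (iffP and3P) => -[S0 clS sS]; split=> //.
  by move=> u v Euv Sv; have /forall_inP/(_ v Sv)/implyP := forallP clS u; apply.
by apply/forallP => u; apply/forall_inP => v Sv; apply/implyP => /clS; apply.
Qed.

Lemma digraphsTE n (E : {set 'I_n * 'I_n}) :
  (E \in digraphs setT) = loopless E && complete E.
Proof.
rewrite inE; have ->: E \subset setX setT setT by apply/subsetP => e; rewrite !inE.
rewrite /=; congr (_ && _); apply/complete_onP/completeP => cE u v; first by apply: cE; rewrite inE.
by move=> _ _; apply: cE.
Qed.

Lemma glue_inj n (S : {set 'I_n}) :
  {in setX (digraphs S) (digraphs (~: S)) &, injective (glue S)}.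
Proof.
move=> [A B] [A' B'] /setXP[/=]; rewrite !inE => /andP[/subsetP sA _] /andP[/subsetP sB _].
case/andP=> /andP[/subsetP sA' _] /andP[/subsetP sB' _] /setP eqG.
congr (_, _); apply/setP => -[u v]; have := eqG (u, v); rewrite !inE /=;
  move: (sA (u, v)) (sB (u, v)) (sA' (u, v)) (sB' (u, v)); rewrite !inE /=;
  case: (u \in S); case: (v \in S) => /=;
  case: (_ \in A); case: (_ \in A'); case: (_ \in B); case: (_ \in B') => //= H1 H2 H3 H4;
  by [have := H1 isT | have := H2 isT | have := H3 isT | have := H4 isT].
Qed.

Lemma disjoint_card (T : finType) (A B : {set T}) :
  (forall x, x \in A -> x \in B -> false) -> #|A :|: B| = #|A| + #|B|.
Proof.
move=> dAB; rewrite cardsU (_ : A :&: B = set0) ?cards0 ?subn0 //.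
by apply/setP => x; rewrite !inE; apply/andP => -[/dAB AB /AB].
Qed.

Lemma card_glue n (S : {set 'I_n}) A B :
  A \in digraphs S -> B \in digraphs (~: S) ->
  #|glue S (A, B)| = #|A| + #|B| + #|S| * #|~: S|.
Proof.
rewrite !inE => /andP[/subsetP sA _] /andP[/subsetP sB _].
rewrite -cardsX /glue !disjoint_card // => -[u v].
  by move=> /sA + /sB; rewrite !inE /= => /andP[->].
rewrite inE; case/orP=> [/sA|/sB]; rewrite !inE /= => /andP[Su Sv].
  by rewrite Sv andbF.
by rewrite (negPf Su).
Qed.

Lemma bin2D a b : 'C(a + b, 2) = 'C(a, 2) + 'C(b, 2) + a * b.
Proof.
by elim: a => [|a IHa]; rewrite ?addn0 // addSn !binS !bin1 IHa; lia.
Qed.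

(** The edges leaving [S] number exactly the cross term of [bin2D], so they contribute no excess. *)
Lemma excess_glue n (S : {set 'I_n}) A B :
  A \in digraphs S -> B \in digraphs (~: S) ->
  excess setT (glue S (A, B)) = excess S A + excess (~: S) B.
Proof.
move=> dA dB; have := digraphs_lower_bound dA; have := digraphs_lower_bound dB.
have := bin2D #|S| #|~: S|; rewrite /excess card_glue // cardsT cardsC card_ord; lia.
Qed.

Lemma glueE n (S : {set 'I_n}) A B u v : A \in digraphs S -> B \in digraphs (~: S) ->
  ((u, v) \in glue S (A, B)) =
    if u \in S then (v \notin S) || ((u, v) \in A)
    else (v \notin S) && ((u, v) \in B).
Proof.
rewrite !inE /= => /andP[/subsetP/(_ (u, v)) + _] /andP[/subsetP/(_ (u, v)) + _].
rewrite !inE /=; case: ((u, v) \in A); case: ((u, v) \in B);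
  by case: (u \in S); case: (v \in S) => //= H H';
  by [have := H isT | have := H' isT].
Qed.

(** No edge enters a source, so completeness forces every edge from [S] to its complement. Only the
    two induced digraphs remain free. *)
Lemma glue_source n (S : {set 'I_n}) : S != set0 ->
  [set E in digraphs setT | is_source S E]
    = glue S @: setX (strong_digraphs S) (digraphs (~: S)).
Proof.
move=> S0; apply/setP => E; rewrite inE digraphsTE; apply/andP/imsetP.
  case=> /andP[lE /completeP cE] /is_sourceP[_ clS sS].
  have dA : E :&: setX S S \in digraphs S.
    rewrite inE subsetIr /=; apply/andP; split.
      by apply/forallP => u; rewrite inE loopless_irr.
    by apply/complete_onP => u v Su Sv uv; rewrite !inE /= Su Sv !andbT cE.
  have dB : E :&: setX (~: S) (~: S) \in digraphs (~: S).
    rewrite inE subsetIr /=; apply/andP; split.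
      by apply/forallP => u; rewrite inE loopless_irr.
    by apply/complete_onP => u v; rewrite !inE /= => -> -> uv; rewrite !andbT cE.
  exists (E :&: setX S S, E :&: setX (~: S) (~: S)).
    by rewrite inE /= dB andbT inE dA.
  apply/setP => -[u v]; rewrite glueE // !inE /=.
  have := clS u v; have := cE u v; case: (eqVneq u v) => [<-|_ /(_ isT)].
    by rewrite loopless_irr // andbF; case: (u \in S).
  have := clS v u; case: (u \in S); case: (v \in S) => //=;
    case: ((u, v) \in E); case: ((v, u) \in E) => //= H H' H''; rewrite ?andbT //;
    by [have := H isT isT | have := H'' isT isT].
case=> -[A B] /setXP[/= + dB] ->; rewrite inE => /andP[dA sA].
have [lA cA] : loopless A /\ complete_on S A by move: dA; rewrite inE => /and3P[].
have [lB cB] : loopless B /\ complete_on (~: S) B by move: dB; rewrite inE => /and3P[].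
split.
  apply/andP; split.
    apply/forallP => u; rewrite glueE //.
    by case: (u \in S); rewrite loopless_irr.
  apply/completeP => u v uv; rewrite !glueE //.
  move/complete_onP/(_ u v): cA; move/complete_onP/(_ u v): cB; rewrite !inE.
  by case: (u \in S); case: (v \in S) => //= H H'; [apply: H' | apply: H].
apply/is_sourceP; split=> // [u v|].
  by rewrite glueE //; case: (u \in S) => // /andP[/negPf->].
suff ->: glue S (A, B) :&: setX S S = A by [].
move: dA; rewrite inE => /andP[/subsetP sAS _].
apply/setP => -[u v]; rewrite inE glueE // ?inE ?sA //=; last first.
  by rewrite lA cA andbT; apply/andP; split => //; apply/subsetP.
by have := sAS (u, v); rewrite !inE /=; case: (u \in S); case: (v \in S);
  rewrite ?andbF ?andbT //= => H; case: (_ \in A) H => // /(_ isT).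
Qed.

(** * Counting complete digraphs with a given source *)

Lemma card_pairs_add (T1 T2 : finType) (X : {set T1}) (Y : {set T2})
    (f : T1 -> nat) (g : T2 -> nat) k :
  #|[set p in setX X Y | f p.1 + g p.2 == k]|
    = \sum_(0 <= l < k.+1) #|[set x in X | f x == l]| * #|[set y in Y | g y == k - l]|.
Proof.
(* On the pairs counted, [f p.1] is at most [k], so [inord] never takes its default value. *)
rewrite big_mkord -sum1_card (partition_big (fun p => inord (f p.1)) (fun l : 'I_k.+1 => true)) //.
apply: eq_bigr => l _; rewrite -cardsX -sum1_card; apply: eq_bigl => -[x y].
rewrite !inE /=; case: (x \in X) => //; case: (y \in Y); rewrite ?andbF //=.
have := ltn_ord l; rewrite ltnS => lk.
apply/andP/andP => -[/eqP H /eqP H'].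
  have fk : f x < k.+1 by rewrite ltnS -H leq_addr.
  by have := congr1 val H'; rewrite /= inordK // => <-; rewrite -H addKn !eqxx.
by rewrite H H' subnKC // eqxx inord_val.
Qed.

Lemma card_source n (S : {set 'I_n}) k : S != set0 ->
  #|[set E in digraphs setT | is_source S E & excess setT E == k]|
    = \sum_(0 <= l < k.+1) w #|S| l * F (n - #|S|) (k - l).
Proof.
move=> S0; have card_SC : #|~: S| = n - #|S| by rewrite cardsCs setCK card_ord.
under eq_bigr do rewrite -card_strong_digraphs_on -card_SC -card_digraphs_on.
rewrite -card_pairs_add -(card_in_imset (f := glue S)); last first.
  move=> p p'; rewrite !inE => /andP[/andP[/andP[dA _] dB] _] /andP[/andP[/andP[dA' _] dB'] _].
  by apply: glue_inj; rewrite !inE ?dA ?dA'.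
apply: eq_card => E.
have -> : (E \in [set E in digraphs setT | is_source S E & excess setT E == k])
   = (E \in [set E in digraphs setT | is_source S E]) && (excess setT E == k).
  by move: (digraphs setT) => D; rewrite !inE andbA.
rewrite glue_source //; apply/andP/imsetP => [[/imsetP[[A B] dAB ->]]|[[A B]]].
  move: (dAB) => /setXP[/= + dB]; rewrite inE => /andP[dA _].
  by rewrite excess_glue // => ex; exists (A, B); rewrite // inE dAB.
rewrite inE => /andP[dAB /= ex] ->; split; first exact: imset_f.
by move: dAB => /setXP[/= + dB]; rewrite inE => /andP[dA _]; rewrite excess_glue.
Qed.

(** * Uniqueness and existence of the source *)

Lemma connect_source n (S : {set 'I_n}) (E : {set 'I_n * 'I_n}) u v :
  (forall u v, (u, v) \in E -> v \in S -> u \in S) ->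
  connect (edge E) u v -> v \in S -> connect (edge (E :&: setX S S)) u v && (u \in S).
Proof.
move=> clS /connectP[p]; elim: p u => [|x p IHp] u /=; first by move=> _ -> ->; rewrite connect0.
case/andP=> Eux px defv Sv; have /andP[cxv Sx] := IHp x px defv Sv.
have Su := clS u x Eux Sx; rewrite Su andbT; apply: connect_trans cxv; apply: connect1.
by rewrite /edge !inE Su Sx !andbT.
Qed.

Lemma source_uniq n (S S' : {set 'I_n}) (E : {set 'I_n * 'I_n}) :
  complete E -> is_source S E -> is_source S' E -> S = S'.
Proof.
move=> /completeP cE.
wlog suff sub: S S' / is_source S E -> is_source S' E -> S \subset S'.
  by move=> sS sS'; apply/eqP; rewrite eqEsubset !sub.
case/is_sourceP=> /set0Pn[a Sa] clS sS /is_sourceP[/set0Pn[b Sb] clS' sS'].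
(* Unless [a] and [b] coincide, an edge joins them, and its tail lies in both sets because neither
   is entered by an edge. *)
have [z Sz Sz'] : exists2 z, z \in S & z \in S'.
  case: (eqVneq a b) => [eq_ab|/cE/orP[Eab|Eba]].
  - by exists a; rewrite // eq_ab.
  - by exists a => //; apply: clS' Eab Sb.
  - by exists b => //; apply: clS Eba Sa.
apply/subsetP => y Sy; have cyz := strong_onP _ _ sS y z Sy Sz.
have {}cyz : connect (edge E) y z.
  by apply: connect_sub cyz => u v; rewrite /edge inE => /andP[? _]; apply: connect1.
by have /andP[] := connect_source clS' cyz Sz'.
Qed.

(* A vertex reaching the largest number of vertices reaches all of them: a
   vertex it missed would have an edge to it, hence reach strictly more. *)
Lemma source_exists n (E : {set 'I_n * 'I_n}) :
  0 < n -> complete E -> exists S, is_source S E.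
Proof.
case: n E => // n E _ /completeP cE.
pose r u := #|connect (edge E) u|.
have [x _ maxx] := arg_maxnP r (isT : xpredT (ord0 : 'I_n.+1)).
have xall y : connect (edge E) x y.
  apply/negPn/negP => nxy.
  have xy : x != y by apply: contraNneq nxy => <-.
  have Eyx : (y, x) \in E.
    case/orP: (cE _ _ xy) => // Exy.
    by rewrite (connect1 (Exy : edge E x y)) in nxy.
  have : r y <= r x by apply: maxx.
  rewrite leqNgt => /negP; apply.
  apply: proper_card; apply/properP; split.
    by apply/subsetP => z; rewrite !inE; apply: connect_trans; apply: connect1.
  by exists y; rewrite !inE.
(* The vertices that reach [x] are those that reach every vertex; hence they are mutually connected
   and closed under predecessors. *)
exists [set y | connect (edge E) y x].
have clS u v : (u, v) \in E -> v \in [set y | connect (edge E) y x] ->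
    u \in [set y | connect (edge E) y x].
  by rewrite !inE => Euv; apply: connect_trans; apply: connect1.
apply/is_sourceP; split=> //; first by apply/set0Pn; exists x; rewrite inE.
apply/strong_onP => u v Su Sv.
have cuv : connect (edge E) u v by apply: connect_trans (xall v); rewrite inE in Su.
by have /andP[] := connect_source clS cuv Sv.
Qed.

(** * The recurrence and the theorem *)

Lemma sum_by_card n (G : nat -> nat) :
  \sum_(S : {set 'I_n}) G #|S| = \sum_(0 <= s < n.+1) 'C(n, s) * G s.
Proof.
rewrite (partition_big (fun S : {set 'I_n} => inord #|S|) (fun s : 'I_n.+1 => true)) // big_mkord.
apply: eq_bigr => s _; have -> : 'C(n, s) = #|[set S : {set 'I_n} | #|S| == s]| by rewrite card_draws card_ord.
rewrite -sum_nat_const.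
have Es (S : {set 'I_n}) : (inord #|S| == s) = (#|S| == s).
  have lt_S : #|S| < n.+1 by rewrite ltnS -[X in _ <= X]card_ord max_card.
  by rewrite -val_eqE /= inordK.
by apply: eq_big => S; rewrite ?Es ?inE // => /eqP->.
Qed.

(** Double counting of pairs of a complete digraph and its source. The term [s = n] is kept here; it
    contains [w n k]. *)
Lemma F_recurrence n k : 0 < n ->
  F n k = \sum_(1 <= s < n.+1) 'C(n, s) *
            \sum_(0 <= l < k.+1) w s l * F (n - s) (k - l).
Proof.
move=> n0.
(* The value at 0 reflects that the empty set is never a source, so the sum may run over all
   subsets. *)
pose G s := if s == 0 then 0 else \sum_(0 <= l < k.+1) w s l * F (n - s) (k - l).
have cardT : #|[set: 'I_n]| = n by rewrite cardsT card_ord.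
transitivity (\sum_(S : {set 'I_n}) G #|S|); last first.
  rewrite sum_by_card big_ltn // muln0 add0n; apply: eq_big_nat => s.
  by case: s.
rewrite -{1}cardT -card_digraphs_on -sum1_card.
(* Each digraph counts 1, which is the number of its sources; then the two sums are exchanged. *)
under eq_bigr => E dE.
  have ->: 1 = \sum_(S | is_source S E) 1.
    move: dE; rewrite inE digraphsTE => /andP[/andP[_ cE] _].
    have [S sS] := source_exists n0 cE.
    rewrite (big_pred1 S) // => S'; apply/idP/eqP => [sS'|->//].
    exact: source_uniq sS' sS.
  over.
rewrite (exchange_big_dep xpredT) //=; apply: eq_bigr => S _.
rewrite /G cards_eq0; case: eqP => [->|/eqP S0].
  by rewrite big1 // => E /andP[_ /is_sourceP[]]; rewrite eqxx.
rewrite -card_source // -sum1_card; apply: eq_bigl => E.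
by rewrite !inE -!andbA; do !bool_congr; rewrite andbC.
Qed.

Lemma card_double_edges_le n (E : {set 'I_n * 'I_n}) :
  loopless E -> #|double_edges E| <= 'C(n, 2).
Proof. by move=> lE; rewrite card_upper_double // -card_upper subset_leq_card // subsetIr. Qed.

Lemma card_generating_sets n (Q : pred nat) :
  #|[set U in generating_sets n | Q #|U|]|
    = #|[set E : {set 'I_n * 'I_n} |
          [&& loopless E, complete E, strongly_connected E
            & Q ('C(n, 2) + #|double_edges E|)]]|.
Proof.
rewrite -[RHS](card_in_imset (f := @moves n)); last first.
  by move=> E E'; rewrite !inE => /andP[lE _] /andP[lE' _]; apply: moves_inj.
apply: eq_card => U; rewrite inE generating_setsE.
apply/andP/imsetP => [[/imsetP[E]]|[E]]; rewrite inE.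
  case/and3P=> lE cE sE ->; rewrite card_moves // card_complete_digraph // => QE.
  by exists E; rewrite // inE lE cE sE.
case/and4P=> lE cE sE QE ->; rewrite card_moves // card_complete_digraph //; split=> //.
by apply: imset_f; rewrite inE lE cE sE.
Qed.

Theorem theorem2p6 :
  (forall n k : nat, k <= 'C(n, 2) ->
     w n k = #|[set U in generating_sets n | #|U| == 'C(n, 2) + k]|)
  /\ (forall n : nat,
        #|generating_sets n| = \sum_(0 <= k < 'C(n, 2).+1) w n k)
  /\ w 0 0 = 1
  /\ (forall n k : nat, 0 < n -> k <= 'C(n, 2) ->
        ((w n k)%:Z = (F n k)%:Z
           - \sum_(1 <= s < n) ('C(n, s))%:Z
               * \sum_(0 <= l < k.+1) (w s l)%:Z * (F (n - s)%N (k - l)%N)%:Z)%R).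
Proof.
have wE n k : w n k = #|[set U in generating_sets n | #|U| == 'C(n, 2) + k]|.
  rewrite (card_generating_sets n (fun m => m == 'C(n, 2) + k)).
  by apply: eq_card => E; rewrite !inE eqn_add2l.
split; first by move=> n k _; apply: wE.
split=> [n|].
  rewrite big_mkord -sum1_card.
  (* For [U = moves E] this is the number of double edges of [E], which is within range by
     [card_double_edges_le]. *)
  pose e (U : {set trans n}) : 'I_('C(n, 2).+1) := inord (#|U| - 'C(n, 2)).
  rewrite (partition_big e xpredT) //; apply: eq_bigr => k _.
  rewrite wE -sum1_card; apply: eq_bigl => U; rewrite inE generating_setsE.
  case: imsetP => //= -[E]; rewrite inE => /and3P[lE cE sE] ->.
  rewrite /e card_moves // card_complete_digraph // addKn eqn_add2l.
  by rewrite -val_eqE /= inordK // ltnS card_double_edges_le.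
split.
  rewrite /w (_ : [set _ | _] = [set set0]) ?cards1 //.
  apply/setP => E; rewrite !inE.
  have ->: E = set0 by apply/setP => -[[]].
  rewrite eqxx; apply/and4P; split; try by apply/forallP => -[].
  by rewrite /double_edges cards_eq0; apply/eqP/setP => A; rewrite inE; apply/imsetP => -[[[]]].
move=> n k n0 _.
have := F_recurrence k n0; rewrite big_nat_recr //= binn mul1n subnn => ->.
(* On no vertices [F 0 0] is 1 and the other values vanish, so only [l = k] survives. *)
have ->: \sum_(0 <= l < k.+1) w n l * F 0 (k - l) = w n k.
  rewrite big_nat_recr //= subnn /F bin0 muln1 big_nat big1 ?add0n // => l /andP[_ lk].
  by rewrite bin_small ?muln0 // subn_gt0.
(* Over the integers the terms with [s < n] can be moved across the equation without truncation. *)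
rewrite PoszD (big_morph Posz PoszD (erefl _)) [(_ + Posz (w n k))%R]GRing.addrC.
rewrite -[LHS](GRing.addrK (\sum_(1 <= s < n) ('C(n, s))%:Z
  * \sum_(0 <= l < k.+1) (w s l)%:Z * (F (n - s)%N (k - l)%N)%:Z)%R).
congr (_ + _ - _)%R; apply: eq_bigr => s _; rewrite PoszM; congr (_ * _)%R.
by rewrite (big_morph Posz PoszD (erefl _)); apply: eq_bigr => l _; rewrite PoszM.
Qed.
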